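(* Let $P:[k]^d\to\mathbb{F}_2$ be any $d$-dimensional tensor of rank at most $t$, and let $f_P(x_1,\dots,x_d)=\sum_{(i_1,\dots,i_d)\in[k]^d}P(i_1,\dots,i_d)x_{1,i_1}\cdots x_{d,i_d}$ be its associated $d$-linear form on $(\mathbb{F}_2^k)^d$. Then $$\mathrm{bias}(f_P)\ge\left(1-\frac{2}{2^d}\right)^t.$$
   Context: A tensor $T:[k]^d\to\mathbb{F}_2$ has rank one if $T(i_1,\dots,i_d)=\prod_{j=1}^d u_j(i_j)$ for some vectors $u_1,\dots,u_d\in\mathbb{F}_2^k$; its rank is the minimum number of rank-one tensors summing to it. $\mathrm{bias}(f)=\left|\mathbb{E}_{x_1,\dots,x_d\in\mathbb{F}_2^k}(-1)^{f(x_1,\dots,x_d)}\right|$. *)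

(* Defs.v *)
From HB Require Import structures.
From mathcomp Require Import all_boot all_order all_algebra.

Set Implicit Arguments.
Unset Strict Implicit.
Unset Printing Implicit Defensive.

Import Order.TTheory GRing.Theory Num.Theory.
Local Open Scope ring_scope.

Section Tensors.
Variables d k : nat.

Definition multi_index := {ffun 'I_d -> 'I_k}.
Definition tensor := {ffun multi_index -> 'F_2}.
Definition args := {ffun 'I_d -> 'rV['F_2]_k}.

Definition rank_one (T : tensor) : bool :=
  [exists u : args, [forall i : multi_index, T i == \prod_(j < d) u j 0 (i j)]].

Definition sum_of_rank_one (T : tensor) (r : nat) : bool :=
  [exists S : {ffun 'I_r -> tensor},
     [forall s : 'I_r, rank_one (S s)] && (T == \sum_(s < r) S s)].

(* T is the sum of the indicators of the points of its support. *)
Lemma sum_of_rank_one_ex (T : tensor) : exists r, sum_of_rank_one T r.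
Proof.
pose e (i : multi_index) : tensor := [ffun i' => (i' == i)%:R].
exists #|[set i | T i != 0]|; apply/existsP.
exists [ffun s => e (enum_val s)]; apply/andP; split.
  apply/forallP => s; rewrite ffunE; apply/existsP.
  set i := enum_val s.
  exists [ffun j => \row_l (l == i j)%:R]; apply/forallP => i'.
  rewrite ffunE; apply/eqP.
  have [->|neq_i] := eqVneq i' i.
    by rewrite big1 // => j _; rewrite ffunE mxE eqxx.
  have [j neq_j] : exists j, i' j != i j.
    apply/existsP; apply: contraR neq_i => /existsPn eq_j.
    by apply/eqP/ffunP => j; apply/eqP; rewrite -[_ == _]negbK eq_j.
  by rewrite (bigD1 j) //= ffunE mxE (negPf neq_j) mul0r.
apply/eqP/ffunP => i.
under eq_bigr do rewrite ffunE.
rewrite -(big_enum_val e) sum_ffunE.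
have F2P (a : 'F_2) : a = (a != 0)%:R by case: a => [[|[|[]]]] //= ?; apply/val_inj.
under eq_bigr do rewrite ffunE.
rewrite [LHS]F2P; case: (boolP (T i != 0)) => Ti.
  rewrite (bigD1 i) ?inE //= eqxx big1 ?addr0 // => i' /andP[_ /negPf].
  by rewrite eq_sym => ->.
rewrite big1 // => i'; rewrite inE => Ti'.
by case: eqP => // eq_i; rewrite eq_i Ti' in Ti.
Qed.

Definition tensor_rank (T : tensor) : nat := ex_minn (sum_of_rank_one_ex T).

Definition multilinear_form (P : tensor) (x : args) : 'F_2 :=
  \sum_(i : multi_index) P i * \prod_(j < d) x j 0 (i j).

(* The exponent is the representative in {0, 1} of f x, through the coercion
   from 'F_2 to nat. *)
Definition bias (R : realFieldType) (f : args -> 'F_2) : R :=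
  `| (\sum_(x : args) (-1) ^+ (f x)) / #|{: args}|%:R |.

End Tensors.

(* Main.v *)
(* Write chi_f = (-1)^f. If f is additive in the j-th argument, the sum of chi_f
   over that argument alone is a character sum, hence nonnegative; so
   sum_x w(x) chi_f(x) >= 0 for every weight w >= 0 that ignores x_j. For linear
   forms l_j with values b_j in {0, 1}, apply this to f + l_m and
   w = prod_(j < m) b_j: since 1 - 2 b_m = (-1)^(l_m), it gives
   2 sum chi_f b_m w <= sum chi_f w. Iterating over all d arguments,
   2^d sum chi_f prod_j b_j <= sum chi_f. As (-1)^(prod_j l_j) = 1 - 2 prod_j b_j,
   adding one rank-one term multiplies sum chi_f by at least 1 - 2 / 2^d. *)

Require Import Defs.
From mathcomp Require Import all_boot all_order all_algebra.
From mathcomp Require Import ring.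

Set Implicit Arguments.
Unset Strict Implicit.
Unset Printing Implicit Defensive.

Import Order.TTheory GRing.Theory Num.Theory.
Local Open Scope ring_scope.

Lemma F2_cases (a : 'F_2) : a = 0 \/ a = 1.
Proof. by case: a => [[|[|[]]]] // ?; [left | right]; apply/val_inj. Qed.

Lemma signF2D (R : realFieldType) (a b : 'F_2) :
  (-1) ^+ (a + b)%R = (-1) ^+ a * (-1) ^+ b :> R.
Proof.
by case: (F2_cases a) => ->; case: (F2_cases b) => ->;
  rewrite /= ?expr0 ?expr1 ?mul1r ?mulr1 ?mulrNN ?mulr1.
Qed.

Lemma signF2E (R : realFieldType) (a : 'F_2) :
  (-1) ^+ a = 1 - 2 * (a : nat)%:R :> R.
Proof.
case: (F2_cases a) => ->; first by rewrite /= expr0 mulr0 subr0.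
by rewrite /= expr1 mulr1 [2]mulr2n opprD addrA subrr sub0r.
Qed.

(** Products of 0s and 1s never need reduction modulo 2, so the passage to representatives is
    multiplicative. *)
Lemma natF2_prod (R : realFieldType) (I : Type) (r : seq I) (l : I -> 'F_2) :
  (nat_of_ord (\prod_(j <- r) l j))%:R = \prod_(j <- r) (l j : nat)%:R :> R.
Proof.
elim/big_rec2: _ => [//|j y x _ <-].
by case: (F2_cases (l j)) => ->; rewrite ?mul0r ?mul1r.
Qed.

Section Update.
Variables d k : nat.
Implicit Types (x : args d k) (j : 'I_d) (a b : 'rV['F_2]_k).

Definition upd x j a : args d k := [ffun i => if i == j then a else x i].

Lemma updE x j a i : upd x j a i = if i == j then a else x i.
Proof. by rewrite ffunE. Qed.

Lemma upd_id x j : upd x j (x j) = x.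
Proof. by apply/ffunP => i; rewrite updE; case: eqP => [->|]. Qed.

Lemma upd_upd x j a b : upd (upd x j a) j b = upd x j b.
Proof. by apply/ffunP => i; rewrite !updE; case: eqP. Qed.

Definition shift j b x := upd x j (x j + b).

Lemma shift_inj j b : injective (shift j b).
Proof.
apply: (can_inj (g := shift j (- b))) => x.
by rewrite /shift upd_upd updE eqxx addrK upd_id.
Qed.

Definition additive_at j (f : args d k -> 'F_2) :=
  forall x a b, f (upd x j (a + b)) = f (upd x j a) + f (upd x j b).

Definition ignores j (T : Type) (w : args d k -> T) :=
  forall x a, w (upd x j a) = w x.

Lemma additive_at_add j f g :
  additive_at j f -> additive_at j g -> additive_at j (fun x => f x + g x).
Proof. by move=> fj gj x a b; rewrite fj gj addrACA. Qed.

End Update.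

Section CharacterSums.
Variables (R : realFieldType) (d k : nat).
Implicit Types (f : args d k -> 'F_2) (j : 'I_d) (w : args d k -> R).

Definition chi f (x : args d k) : R := (-1) ^+ f x.

(* Either f vanishes on the whole line through x in direction j, or translating
   by a point of the line where f = 1 shows that the character sum is its own
   opposite. *)
Lemma line_sum_ge0 f j x :
  additive_at j f -> 0 <= chi f x * \sum_b chi f (upd x j b).
Proof.
move=> fj; have [/forallP f0|] := boolP [forall b, f (upd x j b) == 0].
  have chi1 b : chi f (upd x j b) = 1 by rewrite /chi (eqP (f0 b)).
  rewrite -[in chi f x](upd_id x j) chi1 mul1r sumr_ge0 // => b _.
  by rewrite chi1.
case/forallPn => a fa; suff -> : \sum_b chi f (upd x j b) = 0 by rewrite mulr0.
have {}fa : f (upd x j a) = 1 by case: (F2_cases (f (upd x j a))) fa => [->|//].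
apply/eqP; rewrite -eqNr; apply/eqP.
rewrite [RHS](reindex_inj (addrI a)) -sumrN; apply: eq_bigr => b _.
by rewrite /chi fj signF2D fa expr1 mulN1r.
Qed.

(** Average over all translations in direction [j]. Each is a bijection that preserves [w], so the
    sum times the number of vectors [b] collects into [w]-weighted line sums, which [line_sum_ge0]
    bounds below. *)
Lemma weighted_sum_ge0 f w j :
  additive_at j f -> ignores j w -> (forall x, 0 <= w x) ->
  0 <= \sum_x w x * chi f x.
Proof.
move=> fj wj w0; have K0 : 0 < #|{: 'rV['F_2]_k}|%:R :> R.
  by rewrite ltr0n; apply/card_gt0P; exists 0.
rewrite -(pmulr_rge0 _ K0) mulr_natl -sumr_const.
suff -> : \sum_(b : 'rV['F_2]_k) \sum_x w x * chi f x
        = \sum_x w x * (chi f x * \sum_b chi f (upd x j b)).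
  by apply: sumr_ge0 => x _; rewrite mulr_ge0 // line_sum_ge0.
under [RHS]eq_bigr do rewrite mulrA mulr_sumr.
rewrite [RHS]exchange_big; apply: eq_bigr => b _.
(* After translation by [b], additivity splits [chi f] into its value at [x] and its value at
   [upd x j b]. *)
rewrite (reindex_inj (@shift_inj _ _ j b)); apply: eq_bigr => x _.
by rewrite wj /chi /shift fj signF2D upd_id mulrA.
Qed.

(** The right side minus the left is the weighted character sum of [f + l], because [1 - 2 * l x] is
    the sign of [l x]. *)
Lemma halving f (l : args d k -> 'F_2) w j :
  additive_at j f -> additive_at j l -> ignores j w -> (forall x, 0 <= w x) ->
  2 * \sum_x w x * (l x : nat)%:R * chi f x <= \sum_x w x * chi f x.
Proof.
move=> fj lj wj w0; rewrite -subr_ge0 mulr_sumr -sumrB.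
have := weighted_sum_ge0 (additive_at_add fj lj) wj w0.
congr (_ <= _); apply: eq_bigr => x _.
by rewrite /chi signF2D (signF2E _ (l x)); ring.
Qed.

Lemma product_halving f (l : 'I_d -> 'rV['F_2]_k -> 'F_2) :
  (forall j, additive_at j f) -> (forall j a b, l j (a + b) = l j a + l j b) ->
  2 ^+ d * \sum_(x : args d k) (\prod_j (l j (x j) : nat)%:R) * chi f x
    <= \sum_x chi f x.
Proof.
move=> fadd ladd.
pose W (s : seq 'I_d) (x : args d k) : R := \prod_(j <- s) (l j (x j) : nat)%:R.
(* Directions are added one at a time. Distinctness ensures that [W s] ignores the next direction
   [j], as [halving] requires of its weight. *)
suff H s : uniq s -> 2 ^+ size s * \sum_x W s x * chi f x <= \sum_x chi f x.
  have := H (index_enum 'I_d) (index_enum_uniq _).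
  by rewrite [size _](_ : _ = d) // -[RHS]card_ord cardT enumT.
elim: s => [_|j s IH /andP[js us]] /=.
  by rewrite expr0 mul1r; under eq_bigr do rewrite /W big_nil mul1r.
apply: le_trans (IH us); rewrite exprSr -mulrA ler_pM2l ?exprn_gt0 ?ltr0n //.
have -> : \sum_x W (j :: s) x * chi f x
        = \sum_x W s x * (l j (x j) : nat)%:R * chi f x.
  by apply: eq_bigr => x _; rewrite /W big_cons [_ * \prod_(_ <- _) _]mulrC.
apply: (halving (l := fun x => l j (x j)) (j := j)) => //.
- by move=> x a b; rewrite !updE eqxx ladd.
- move=> x a; rewrite /W big_seq [RHS]big_seq; apply: eq_bigr => i is_.
  by rewrite updE; case: eqP => // ij; rewrite -ij is_ in js.
- by move=> x; apply: prodr_ge0.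
Qed.

Lemma add_product_form f (l : 'I_d -> 'rV['F_2]_k -> 'F_2) :
  (forall j, additive_at j f) -> (forall j a b, l j (a + b) = l j a + l j b) ->
  (1 - 2 / 2 ^+ d) * \sum_x chi f x
    <= \sum_x chi (fun x : args d k => f x + \prod_j l j (x j)) x.
Proof.
move=> fadd ladd.
pose S := \sum_(x : args d k) (\prod_j (l j (x j) : nat)%:R) * chi f x.
have -> : \sum_x chi (fun x : args d k => f x + \prod_j l j (x j)) x
        = \sum_x chi f x - 2 * S.
  rewrite mulr_sumr -sumrB; apply: eq_bigr => x _.
  by rewrite /chi signF2D (signF2E _ (\prod_j _)) natF2_prod; ring.
rewrite mulrBl mul1r lerD2l lerN2 -mulrA ler_pM2l ?ltr0n //.
by rewrite ler_pdivlMl ?exprn_gt0 ?ltr0n //; apply: product_halving.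
Qed.

End CharacterSums.

Section MultilinearForms.
Variables d k : nat.

Lemma multilinear_form_additive (P : tensor d k) j :
  additive_at j (multilinear_form P).
Proof.
move=> x a b; rewrite /multilinear_form -big_split; apply: eq_bigr => i _.
have split_j c : \prod_(j' < d) upd x j c j' 0 (i j')
    = c 0 (i j) * \prod_(j' < d | j' != j) x j' 0 (i j').
  rewrite (bigD1 j) //= updE eqxx; congr (_ * _).
  by apply: eq_bigr => j' /negPf ne; rewrite updE ne.
by rewrite /= !split_j mxE -mulrDr mulrDl.
Qed.

Lemma multilinear_formD (P Q : tensor d k) x :
  multilinear_form (P + Q) x = multilinear_form P x + multilinear_form Q x.
Proof.
rewrite /multilinear_form -big_split; apply: eq_bigr => i _.
by rewrite ffunE mulrDl.
Qed.

Lemma multilinear_form0 x : multilinear_form (0 : tensor d k) x = 0.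
Proof. by apply: big1 => i _; rewrite ffunE mul0r. Qed.

Lemma multilinear_form_rank_one (T : tensor d k) : rank_one T ->
  exists u : args d k, forall x,
    multilinear_form T x = \prod_j \sum_i u j 0 i * x j 0 i.
Proof.
case/existsP => u /forallP Tu; exists u => x.
(* Expanding the product of sums gives one term per choice of an index in each direction, that is,
   per multi-index. *)
rewrite bigA_distr_bigA; apply: eq_bigr => i _.
by rewrite (eqP (Tu i)) big_split.
Qed.

(** The zero form has sign 1 everywhere, and each rank-one term costs one factor [1 - 2 / 2 ^+ d].
    Its nonnegativity lets the induction hypothesis be multiplied by it. *)
Lemma sum_chi_rank (R : realFieldType) (S : seq (tensor d k)) :
  0 <= 1 - 2 / 2 ^+ d :> R -> all (@rank_one d k) S ->
  (1 - 2 / 2 ^+ d) ^+ size S * #|{: args d k}|%:R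
    <= \sum_x chi R (multilinear_form (\sum_(T <- S) T)) x.
Proof.
move=> c0; elim: S => [_|T S IH /andP[]].
  rewrite expr0 mul1r big_nil -sumr_const; apply: ler_sum => x _.
  by rewrite /chi multilinear_form0.
case/multilinear_form_rank_one => u Tu /IH {}IH; rewrite exprS -mulrA.
apply: le_trans (ler_wpM2l c0 IH) _.
(* The form of [T] is the product over [j] of the pairings with the vectors [u j]. *)
pose l j (y : 'rV['F_2]_k) := \sum_i u j 0 i * y 0 i.
have := @add_product_form R _ _ (multilinear_form (\sum_(T <- S) T)) l.
rewrite (_ : \sum_x chi _ (fun _ => _ + _) x
  = \sum_x chi R (multilinear_form (\sum_(T <- T :: S) T)) x).
  apply => [j|j a b]; first exact: multilinear_form_additive.
  by rewrite -big_split; apply: eq_bigr => i _; rewrite mxE mulrDr.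
by apply: eq_bigr => x _; rewrite /chi big_cons multilinear_formD Tu addrC.
Qed.

End MultilinearForms.

(** There is only the empty tuple of arguments, so the average is a single sign. *)
Lemma bias_dim0 (R : realFieldType) (k : nat) (f : args 0 k -> 'F_2) :
  bias R f = 1.
Proof.
pose x0 : args 0 k := [ffun=> 0].
have all0 x : x = x0 by apply/ffunP => -[].
rewrite /bias (bigD1 x0) //= big1 => [|x]; last by rewrite (all0 x) eqxx.
rewrite addr0 normrM normfV normr_nat (@eq_card1 _ x0); last first.
  by move=> x; rewrite !inE (all0 x) eqxx.
by rewrite invr1 mulr1 normrX normrN1 expr1n.
Qed.

Theorem theorem4p1 (R : realFieldType) (d k t : nat) (P : tensor d k)
    (hP : (tensor_rank P <= t)%N) :
  (1 - 2 / 2 ^+ d) ^+ t <= bias R (multilinear_form P).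
Proof.
(* For d = 0 the base is -1, so monotonicity in t fails there. *)
have [d0|d_gt0] := posnP d.
  subst d; rewrite bias_dim0 (le_trans (ler_norm _)) // normrX.
  by rewrite expr0 divr1 -opprB normrN [2]mulr2n addrK normr1 expr1n.
have p0 : 0 < 2 ^+ d :> R by rewrite exprn_gt0 ?ltr0n.
have c0 : 0 <= 1 - 2 / 2 ^+ d :> R.
  (* Since [d] is positive, [2 = 2 ^+ 1 <= 2 ^+ d]. *)
  rewrite subr_ge0 ler_pdivrMr // mul1r -{1}[2]expr1.
  by rewrite ler_weXn2l // ler1n.
have c1 : 1 - 2 / 2 ^+ d <= 1 :> R.
  by rewrite gerBl divr_ge0 ?ler0n // ltW.
(* With base in [0, 1], replacing the exponent [t] by the exact rank can only increase the power. *)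
apply: le_trans (ler_wiXn2l c0 c1 hP) _.
rewrite /tensor_rank; case: ex_minnP => r /existsP[S /andP[/forallP S1 /eqP PS]] _.
have N0 : 0 < #|{: args d k}|%:R :> R.
  by rewrite ltr0n; apply/card_gt0P; exists [ffun=> 0].
apply: le_trans (ler_norm _); rewrite ler_pdivlMr //.
have := @sum_chi_rank d k R [seq S s | s <- enum 'I_r] c0.
rewrite size_map size_enum_ord big_map big_enum /= -PS; apply.
by apply/allP => T /mapP[s _ ->].
Qed.
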